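(* Let $G=\mathbb{Z}_2^n$ and let $A,B\subseteq G$ be such that $\langle A\rangle = G$, $B\neq\varnothing$ and $|A|\le \frac34|G|$. Let $t$ be the largest positive integer such that $$|A|\le \frac{t+1}{2^t}\cdot|G|,$$ and let the integer $k$ with $0\le k<t$ and the real number $w\in[-1,1]$ be such that $$|B| = \frac{\binom{t}{0}+\binom{t}{1}+\dots+\binom{t}{k}+w\binom{t-1}{k}}{2^t}\cdot|G|.$$ Then $$|A+B|\ \ge\ \frac{\binom{t}{0}+\binom{t}{1}+\dots+\binom{t}{k}+\binom{t}{k+1}+w\binom{t-1}{k+1}}{2^t}\cdot|G|.$$ This bound is tight when $w=0$: for integers $t\ge 2$, $0\le k<t$ and $n\ge t$, it is attained (with these $t,k$ and $w=0$) by the sets $$A=D_1^t\times\mathbb{Z}_2^{n-t},\qquad B=D_k^t\times\mathbb{Z}_2^{n-t},\qquad A+B=D_{k+1}^t\times\mathbb{Z}_2^{n-t}.$$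
   Context: $\mathbb{Z}_2^n$ is the $n$-dimensional vector space over the field with two elements, and $A+B=\{a+b : a\in A,\ b\in B\}$. The affine span $\langle A\rangle$ is the smallest coset (of any subgroup) containing $A$. For integers $k,t\ge 0$, $D_k^t=\{x\in\mathbb{Z}_2^t : \#\{i : x_i=1\}\le k\}$ is the Hamming ball of radius $k$ in $\mathbb{Z}_2^t$. Convention: $\binom{a}{b}=0$ for integers $0\le a<b$. *)

(* Defs.v *)
From mathcomp Require Import all_boot all_order all_fingroup all_algebra.
From mathcomp Require Import reals.

Set Implicit Arguments.
Unset Strict Implicit.
Unset Printing Implicit Defensive.

Import Order.TTheory GRing.Theory Num.Theory.
Local Open Scope ring_scope.

(* {group 'rV['F_2]_n} are the subgroups for the additive structure, so that
   H :* x is the coset H + x. *)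
Definition is_coset n (C : {set 'rV['F_2]_n}) : Prop :=
  exists (H : {group 'rV['F_2]_n}) (x : 'rV['F_2]_n), C = (H :* x)%g.

Definition is_affine_span n (A C : {set 'rV['F_2]_n}) : Prop :=
  [/\ is_coset C, A \subset C &
      forall D : {set 'rV['F_2]_n}, is_coset D -> A \subset D -> C \subset D].

Definition sumset n (A B : {set 'rV['F_2]_n}) : {set 'rV['F_2]_n} :=
  [set a + b | a in A, b in B].

Definition hamming_ball k t : {set 'rV['F_2]_t} :=
  [set x : 'rV['F_2]_t | (#|[set i | x 0%R i == 1%R]| <= k)%N].

(* The copy of X * Z_2^(n-t) in Z_2^n: the first t coordinates lie in X. *)
Definition cylinder n t (le_tn : (t <= n)%N) (X : {set 'rV['F_2]_t}) :
    {set 'rV['F_2]_n} :=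
  [set castmx (erefl 1%N, subnKC le_tn) (row_mx x y)
     | x in X, y in [set: 'rV['F_2]_(n - t)]].

Definition is_largest_index (R : realType) n (A : {set 'rV['F_2]_n}) (t : nat) :
    Prop :=
  let P s := (0 < s)%N /\
    #|A|%:R <= (s.+1)%:R / 2 ^+ s * #|{: 'rV['F_2]_n}|%:R :> R in
  P t /\ forall s : nat, P s -> (s <= t)%N.

(* At k = t the term in w vanishes, since 'C(t.-1, t) = 0. *)
Definition ball_density (R : realType) (t k : nat) (w : R) : R :=
  (\sum_(i < k.+1) 'C(t, i)%:R + w * 'C(t.-1, k)%:R) / 2 ^+ t.

(* Main.v *)
Require Import Defs.
From mathcomp Require Import all_boot all_order all_fingroup all_algebra.
From mathcomp Require Import reals.
From mathcomp Require Import zify ring lra.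

Set Implicit Arguments.
Unset Strict Implicit.
Unset Printing Implicit Defensive.

Import Order.TTheory GRing.Theory Num.Theory.
Local Open Scope ring_scope.

(** Write m = t - 1.  As w runs over [-1, 1] and k over 0, ..., m, the pairs
    (density of B, claimed density of A + B) describe the graph of the concave
    piecewise linear function f_m that sends the density of the ball of radius
    k - 1 of Z_2^m to that of the ball of radius k.  The maximality of t gives
    |A| > (t + 2) / 2^(t + 1) |G|, and |A| <= 3/4 |G| gives t >= 2.  Under these two
    conditions the bound |A + B| >= f_m(|B|) is proved for all A containing 0 and
    the unit vectors, by induction on m ([frame_sumset]).

    Compression.  Fix v with leading bit p.  In each pair {x, x + v} move the
    element of A with bit p equal to 1, if its partner is absent, onto the
    partner; do the same with B.  Sizes are kept and |A + B| does not grow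
    ([sumset_compress]).  Only compressions after which A still contains 0 and
    the unit vectors are used.  When none of them changes A, and A is not the
    whole space, A consists of a coordinate subspace K, spanned by the first h
    unit vectors, and of elements having a single bit from h on ([shifted_low]):
    an element with two such bits would force the span of the first h + 1 unit
    vectors into A.

    Induction.  Cut A into A_0, A_1 and B into B_0, B_1 by the last bit.  Among the
    bits from h on it is the one carried by fewest elements of A, so counting shows
    that A_0 satisfies the same hypotheses with m - 1 ([shifted_section]).  If
    B_0 is the larger half of B, then
      |A + B| >= |A_0 + B_0| + max(|A_0 + B_1|, |B_0|),
    and the induction hypothesis gives f_(m-1) at both halves.  By concavity the
    right-hand side is least when B_1 and B_0 lie at the parameters (k - 1, w) and
    (k, w) of the graph of f_(m-1), where Pascal's rule turns it into f_m(|B|)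
    exactly ([profile_sections]).  The induction starts at m = 1, where |A| > |G| / 2 and the bound is min(|G|, |G| / 2 + |B|).

    A set with full affine span contains 0 and the unit vectors after a
    translation and a linear change of coordinates ([exists_frame]).  Tightness
    is a count: D_1 + D_k = D_(k+1), and cylinders commute with sums. *)

(** * Vectors over the field with two elements *)

Lemma F2_neq0 (a : 'F_2) : (a != 0) = (a == 1).
Proof. by case: a => [[|[|]]]. Qed.

Lemma F2_add_neq0 (a b : 'F_2) : (a + b != 0) = (a != 0) (+) (b != 0).
Proof. by case: a => [[|[|]]] // ?; case: b => [[|[|]]]. Qed.

Lemma F2_addrr n (x : 'rV['F_2]_n) : x + x = 0.
Proof.
by apply/rowP => i; rewrite !mxE; case: (x 0 i) => [[|[|]]] // ?; apply/val_inj.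
Qed.

Lemma F2_addrK n (y : 'rV['F_2]_n) : involutive (fun x => x + y).
Proof. by move=> x; rewrite -addrA F2_addrr addr0. Qed.

Lemma F2_rowP n (x y : 'rV['F_2]_n) :
  (forall i, (x 0 i != 0) = (y 0 i != 0)) -> x = y.
Proof.
move=> xy; apply/rowP => i; move: (xy i).
by case: (x 0 i) => [[|[|]]] // ?; case: (y 0 i) => [[|[|]]] // ? _; apply/val_inj.
Qed.

Definition unitv n (i : 'I_n) : 'rV['F_2]_n := delta_mx 0 i.

Lemma unitvE n (i j : 'I_n) : (unitv i 0 j != 0) = (j == i).
Proof. by rewrite mxE eqxx /=; case: (j == i). Qed.

Definition frame n : {set 'rV['F_2]_n} := 0 |: [set unitv i | i : 'I_n].

Lemma frame0 n (A : {set 'rV['F_2]_n}) : frame n \subset A -> 0 \in A.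
Proof. by move/subsetP; apply; rewrite setU11. Qed.

Lemma frame_unitv n (A : {set 'rV['F_2]_n}) i : frame n \subset A -> unitv i \in A.
Proof. by move/subsetP; apply; rewrite setU1r ?imset_f. Qed.

(** * Compressions *)

(** Coordinates of larger index are more significant, so p is the leading bit of v. *)
Definition pivot n (p : 'I_n) (v : 'rV['F_2]_n) :=
  (v 0 p != 0) && [forall i : 'I_n, (p < i)%N ==> (v 0 i == 0)].

(** In each pair {x, x + v} the points of A are pushed towards bit p equal to 0.
    The bit p of v has to be 1. *)
Definition compress n (p : 'I_n) (v : 'rV['F_2]_n) (A : {set 'rV['F_2]_n}) :
    {set 'rV['F_2]_n} :=
  [set x : 'rV['F_2]_n | if x 0 p != 0 then (x \in A) && (x + v \in A)
           else (x \in A) || (x + v \in A)].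

(** Each pair {x, x + v} has exactly one member whose bit p is 0. *)
Lemma sum_pairs n (p : 'I_n) (v : 'rV['F_2]_n) (F : 'rV['F_2]_n -> nat) : v 0 p != 0 ->
  (\sum_x F x = \sum_(x : 'rV['F_2]_n | x 0%R p == 0%R) (F x + F (x + v)%R))%N.
Proof.
move=> vp; rewrite big_split /= (bigID (fun x : 'rV['F_2]_n => x 0 p == 0)) /=.
congr addn; rewrite (reindex_inj (can_inj (F2_addrK v))) /=.
by apply: eq_bigl => x; rewrite mxE F2_add_neq0 vp addbT negbK.
Qed.

Lemma mem_compress0 n (p : 'I_n) (v : 'rV['F_2]_n) A (x : 'rV['F_2]_n) :
  v 0 p != 0 -> x 0 p == 0 ->
  ((x \in compress p v A) = (x \in A) || (x + v \in A)) *
  ((x + v \in compress p v A) = (x \in A) && (x + v \in A)).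
Proof.
move=> vp xp; rewrite !inE mxE F2_add_neq0 vp xp /= F2_addrK.
by rewrite andbC.
Qed.

Lemma card_sum_mem n (A : {set 'rV['F_2]_n}) : #|A| = (\sum_x (x \in A))%N.
Proof. by rewrite -sum1_card big_mkcond /=; apply: eq_bigr => x _; case: ifP. Qed.

Lemma card_compress n (p : 'I_n) (v : 'rV['F_2]_n) A : v 0 p != 0 -> #|compress p v A| = #|A|.
Proof.
move=> vp; rewrite !card_sum_mem !(sum_pairs _ vp).
apply: eq_bigr => x xp; rewrite !(mem_compress0 _ vp xp).
by case: (x \in A); case: (_ \in A).
Qed.

Lemma mem_sumset n (A B : {set 'rV['F_2]_n}) a b :
  a \in A -> b \in B -> a + b \in sumset A B.
Proof. exact: imset2_f. Qed.

(** The sum of the pairs {x, x + v} and {y, y + v} is the single pair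
    {x + y, x + y + v}, so the inclusion can be checked on one pair at a time. *)
Lemma sumset_compress n (p : 'I_n) (v : 'rV['F_2]_n) (A B : {set 'rV['F_2]_n}) : v 0 p != 0 ->
  sumset (compress p v A) (compress p v B) \subset compress p v (sumset A B).
Proof.
move=> vp; apply/subsetP => _ /imset2P[x y xA yB ->].
have S0 a b : a \in A -> b \in B -> a + b \in sumset A B by exact: mem_sumset.
have E1 : x + v + y = x + y + v by rewrite addrAC.
have E2 : x + (y + v) = x + y + v by rewrite addrA.
have E3 : (x + v) + (y + v) = x + y by rewrite addrACA F2_addrr addr0.
have := (S0 x y, S0 (x + v) y, S0 x (y + v), S0 (x + v) (y + v)).
rewrite E1 E2 E3 => -[[[H1 H2] H3] H4].
move: xA yB; rewrite !inE mxE F2_add_neq0.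
case: ifP => _; case: ifP => _ /=.
- by case/andP=> a1 a2 /andP[b1 b2]; rewrite (H1 a1 b1).
- by case/andP=> a1 a2 /orP[b|b]; [rewrite (H1 a1 b) (H2 a2 b)|rewrite (H3 a1 b) (H4 a2 b)].
- by case/orP=> a /andP[b1 b2]; [rewrite (H1 a b1) (H3 a b2)|rewrite (H2 a b1) (H4 a b2)].
- by case/orP=> a /orP[b|b]; rewrite ?(H1 a b) ?(H2 a b) ?(H3 a b) ?(H4 a b) ?orbT.
Qed.

Definition binval n (x : 'rV['F_2]_n) : nat := (\sum_(i < n) (x ord0 i != 0%R) * 2 ^ i)%N.

Lemma sum_pow2 m : (\sum_(i < m) 2 ^ i = (2 ^ m).-1)%N.
Proof.
elim: m => [|m IH]; first by rewrite big_ord0.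
by rewrite big_ord_recr /= IH expnS; have := expn_gt0 2 m; lia.
Qed.

(** Adding v leaves the bits above p alone and sets bit p, which outweighs all the
    bits below it. *)
Lemma binval_pivot n (p : 'I_n) (v x : 'rV['F_2]_n) :
  pivot p v -> x 0 p == 0 -> (binval x < binval (x + v)%R)%N.
Proof.
case/andP=> vp /forallP vi xp.
rewrite /binval (bigID (fun i : 'I_n => (p < i)%N)).
rewrite [X in (_ < X)%N](bigID (fun i : 'I_n => (p < i)%N)) /=.
have -> : (\sum_(i < n | (p < i)%N) ((x + v)%R ord0 i != 0%R) * 2 ^ i =
   \sum_(i < n | (p < i)%N) (x ord0 i != 0%R) * 2 ^ i)%N.
  by apply: eq_bigr => i pi; move: (vi i); rewrite pi mxE => /eqP ->; rewrite addr0.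
rewrite ltn_add2l [X in (_ < X)%N](bigD1 p) ?ltnn //= mxE F2_add_neq0 vp xp /= mul1n.
apply: (@leq_trans (2 ^ p)); last exact: leq_addr.
rewrite (bigD1 p) ?ltnn //= xp mul0n add0n.
apply: (@leq_ltn_trans (\sum_(i < n | (i < p)%N) 2 ^ i)).
  rewrite [X in (X <= _)%N](eq_bigl (fun i : 'I_n => (i < p)%N)); last first.
    by move=> i; rewrite -leqNgt ltn_neqAle andbC.
  by apply: leq_sum => i _; case: (_ != _); rewrite ?mul1n.
rewrite -(big_ord_widen_cond n xpredT (fun i => 2 ^ i)%N) ?(ltnW (ltn_ord p)) //.
by rewrite sum_pow2; have := expn_gt0 2 p; lia.
Qed.

(** Among all pairs of sets that satisfy the first four conditions, take one whose
    first set has the least total binary value: a compression that keeps E and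
    moves a point would lower it.  With E the frame, spanning survives; with E
    empty, every compression is allowed. *)
Lemma exists_stable n (E A B : {set 'rV['F_2]_n}) : E \subset A ->
  exists A' B' : {set 'rV['F_2]_n},
  [/\ #|A'| = #|A|, #|B'| = #|B|, (#|sumset A' B'| <= #|sumset A B|)%N, E \subset A' &
     forall p v, pivot p v -> E \subset compress p v A' -> compress p v A' = A'].
Proof.
move=> EA.
pose ok (X : {set 'rV['F_2]_n} * {set 'rV['F_2]_n}) :=
  [&& #|X.1| == #|A|, #|X.2| == #|B|,
      (#|sumset X.1 X.2| <= #|sumset A B|)%N & E \subset X.1].
have ok0 : ok (A, B) by rewrite /ok /= !eqxx leqnn.
case: (@arg_minnP _ (A, B) ok (fun X => \sum_(x in X.1) binval x)%N ok0).
case=> A' B' /and4P[/= /eqP cA /eqP cB sAB EA'] mini.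
exists A', B'; split=> // p v pv Ecomp; have /andP[vp _] := pv.
have := mini (compress p v A', compress p v B').
rewrite /ok /= !card_compress // cA cB !eqxx Ecomp andbT /=.
have -> : (#|sumset (compress p v A') (compress p v B')| <= #|sumset A B|)%N.
  apply: leq_trans sAB; rewrite -(card_compress (sumset A' B') vp).
  by rewrite subset_leq_card // sumset_compress.
move=> /(_ isT).
have mk (X : {set 'rV['F_2]_n}) : (\sum_(x in X) binval x = \sum_x (x \in X) * binval x)%N.
  by rewrite big_mkcond; apply: eq_bigr => x _; case: (_ \in _); rewrite ?mul1n.
rewrite !mk !(sum_pairs _ vp) => le_sums.
have le_terms (x : 'rV['F_2]_n) : x 0 p == 0 ->
  ((x \in compress p v A') * binval x + (x + v \in compress p v A')%R * binval (x + v)%R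
   <= (x \in A') * binval x + (x + v \in A')%R * binval (x + v)%R
   ?= iff (x \in A') || (x + v \notin A')%R)%N.
  move=> xp; rewrite !(mem_compress0 _ vp xp); have := binval_pivot pv xp.
  case: (x \in A'); case: (_ \in A') => /= lt_b; apply/leqifP;
  by rewrite ?mul1n ?mul0n //=; lia.
have [ge_sums eq_sums] := leqif_sum le_terms.
have /forallP all_ok :
    [forall (x : 'rV['F_2]_n | x 0 p == 0), (x \in A') || (x + v \notin A')].
  by rewrite -eq_sums eqn_leq ge_sums.
apply/setP => x.
case: (boolP (x 0 p == 0)) => [xp|xp].
  rewrite (mem_compress0 _ vp xp); move/implyP: (all_ok x) => /(_ xp).
  by case: (x \in A'); case: (_ \in A').
have xvp : (x + v) 0 p == 0 by rewrite -[_ == 0]negbK mxE F2_add_neq0 vp addbT negbK.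
rewrite -[x](F2_addrK v) (mem_compress0 _ vp xvp).
move/implyP: (all_ok (x + v)) => /(_ xvp).
by case: (x + v \in A'); case: (_ \in A').
Qed.

(** * Structure of compressed sets *)

(** The coordinate subspace spanned by the first h unit vectors. *)
Definition low n h : {set 'rV['F_2]_n} :=
  [set x : 'rV['F_2]_n | [forall i : 'I_n, (h <= i)%N ==> (x 0 i == 0)]].

Lemma lowP n h (x : 'rV['F_2]_n) :
  reflect (forall i : 'I_n, (h <= i)%N -> x 0 i = 0) (x \in low n h).
Proof.
rewrite inE; apply: (iffP forallP) => xh i; first by move/(implyP (xh i))/eqP.
by apply/implyP => /xh ->.
Qed.

Arguments lowP {n h x}.

Lemma low_unitv n h (i : 'I_n) : (i < h)%N -> unitv i \in low n h.
Proof.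
move=> ih; apply/lowP => j hj; apply/eqP; rewrite -[_ == 0]negbK unitvE.
by apply: contraL hj => /eqP->; rewrite -ltnNge.
Qed.

Lemma low_add n h (x y : 'rV['F_2]_n) : x \in low n h -> y \in low n h -> x + y \in low n h.
Proof.
by move=> /lowP xh /lowP yh; apply/lowP => i hi; rewrite mxE xh ?yh ?addr0.
Qed.

Lemma card_low n h : (h <= n)%N -> #|low n h| = (2 ^ h)%N.
Proof.
elim: h => [|h IH] hn.
  rewrite expn0; transitivity #|[set (0 : 'rV['F_2]_n)]|; last exact: cards1.
  apply: eq_card => x; rewrite !inE.
  apply/forallP/eqP => [x0|-> i]; last by rewrite mxE eqxx implybT.
  by apply/rowP => i; move/(_ i): x0; rewrite mxE => /eqP.
pose u := unitv (Ordinal hn).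
have uN : u 0 (Ordinal hn) != 0 by rewrite unitvE.
rewrite expnS mul2n -addnn -(IH (ltnW hn)).
rewrite -[X in (X + _)%N](card_imset _ (can_inj (F2_addrK u))) /=.
rewrite -cardsUI [X in (_ + #|pred_of_set X|)%N](_ : _ = set0) ?cards0 ?addn0; last first.
  apply/eqP; rewrite -subset0; apply/subsetP => x.
  rewrite inE => /andP[/imsetP[y /lowP yh ->] /lowP].
  move/(_ (Ordinal hn) (leqnn _)); rewrite mxE yh //= add0r => u0.
  by rewrite u0 eqxx in uN.
apply: eq_card => x; apply/idP/setUP => [xh|].
  case: (boolP (x 0 (Ordinal hn) == 0)) => [x0|xN]; [right|left].
    apply/lowP => i; rewrite leq_eqVlt => /orP[/eqP hi|]; last exact: (lowP xh).
    by move/eqP: x0 => <-; congr (x 0 _); apply/val_inj.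
  apply/imsetP; exists (x + u); last by rewrite F2_addrK.
  apply/lowP => i; rewrite leq_eqVlt => /orP[/eqP hi|hi].
    have -> : i = Ordinal hn by apply/val_inj.
    by apply/eqP; rewrite -[_ == 0]negbK mxE F2_add_neq0 xN uN.
  by apply: (lowP (low_add xh (low_unitv _))) => //=.
have lowS y : y \in low n h -> y \in low n h.+1.
  by move/lowP => yh; apply/lowP => i /ltnW/yh.
by case=> [/imsetP[y /lowS yh ->]|/lowS //]; apply: low_add => //; apply: low_unitv.
Qed.

(** A bit m of an element of A may be traded for any v in A made of lower bits;
    v = 0 clears the bit, v a unit vector moves it down. *)
Definition shifted n (A : {set 'rV['F_2]_n}) := forall (x v : 'rV['F_2]_n) (m : 'I_n),
  x \in A -> x 0 m != 0 -> v \in A -> v \in low n m -> x + unitv m + v \in A.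

(** The compression along [unitv m + v] can only endanger [unitv m], whose partner
    is v; hence it keeps the frame as soon as v is in A. *)
Lemma stable_shifted n (A : {set 'rV['F_2]_n}) : frame n \subset A ->
  (forall p v, pivot p v -> frame n \subset compress p v A -> compress p v A = A) ->
  shifted A.
Proof.
move=> fA stab x v m xA xm vA /lowP vm.
pose w := unitv m + v.
have wm : pivot m w.
  apply/andP; split; first by rewrite mxE F2_add_neq0 unitvE eqxx vm ?eqxx.
  apply/forallP => i; apply/implyP => mi.
  by rewrite -[_ == 0]negbK mxE F2_add_neq0 unitvE vm ?(ltnW mi) // -val_eqE gtn_eqF.
have /setP /(_ x) : compress m w A = A.
  apply: stab wm _; apply/subsetP => y; rewrite !inE => /predU1P[->|/imsetP[i _ ->]].
    by rewrite mxE eqxx frame0.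
  rewrite unitvE frame_unitv //; case: eqP => //= <-.
  by rewrite addrA F2_addrr add0r.
by rewrite inE xm xA addrA => /= ->.
Qed.

Lemma shifted_down n (A : {set 'rV['F_2]_n}) (x y : 'rV['F_2]_n) :
  shifted A -> 0 \in A -> x \in A ->
  (forall i, y 0 i != 0 -> x 0 i != 0) -> y \in A.
Proof.
move=> shA A0; have [c] := ubnP #|[set i | x 0 i != y 0 i]|.
elim: c x => // c IH x xc xA yx.
have [/eqP|[i]] := set_0Vmem [set i | x 0 i != y 0 i].
  rewrite -subset0 => /subsetP xy; suff -> : y = x by [].
  by apply/rowP => i; have := xy i; rewrite !inE; case: eqP => // _ /(_ isT).
rewrite inE => xyi.
have yi : y 0 i = 0.
  apply/eqP; apply: contraNT xyi => yi; have := yx i yi.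
  by move: yi; rewrite !F2_neq0 => /eqP-> /eqP->.
have xi : x 0 i != 0 by rewrite yi in xyi.
have ui j : j != i -> (x + unitv i) 0 j = x 0 j.
  move=> ji; apply/eqP; rewrite -subr_eq0 mxE addrAC subrr add0r.
  by rewrite -[_ == 0]negbK unitvE.
apply: (IH (x + unitv i)).
- rewrite -ltnS; apply: leq_trans xc; rewrite ltnS; apply: proper_card; apply/properP; split.
    apply/subsetP => j; rewrite !inE; case: (eqVneq j i) => [->|/ui->] //.
  exists i; rewrite !inE // negbK yi -[_ == 0]negbK mxE F2_add_neq0 unitvE eqxx xi //.
- by rewrite -[_ + _]addr0; apply: shA => //; apply/lowP => j _; rewrite mxE.
- by move=> j yj; rewrite ui ?yx //; apply: contraNneq yj => ->; rewrite yi.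
Qed.

(** Let h be maximal with [low n h] inside A.  If an element of A had two bits
    i < j from h on, clearing its other bits and moving i down to h would give
    [unitv h + unitv j]; trading bit j for the elements of [low n h] would then put
    [low n h.+1] inside A. *)
Lemma shifted_low n (A : {set 'rV['F_2]_n}) :
  shifted A -> frame n \subset A -> A != setT ->
  exists2 h : nat, (h < n)%N & low n h \subset A /\
   forall (x : 'rV['F_2]_n) (i j : 'I_n), x \in A -> (h <= i)%N -> (h <= j)%N ->
     x 0 i != 0 -> x 0 j != 0 -> i = j.
Proof.
move=> shA fA AT; have A0 := frame0 fA.
have exh : exists h, ~~ (low n h \subset A).
  exists n; apply: contra AT; rewrite eqEsubset subsetT => /subsetP lA; apply/subsetP => x _.
  by apply: lA; apply/lowP => i; rewrite leqNgt ltn_ord.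
case: (ex_minnP exh) => -[|h] hA hmin.
  case/negP: hA; apply/subsetP => x /lowP x0; suff -> : x = 0 by [].
  by apply/rowP => i; rewrite mxE x0.
have hn : (h < n)%N.
  apply: contraT; rewrite -leqNgt => nh.
  suff : (h < h)%N by rewrite ltnn.
  apply: hmin; apply: contra hA => /subsetP lA; apply/subsetP => x _; apply: lA.
  by apply/lowP => i; rewrite leqNgt (leq_trans (ltn_ord i) nh).
have lowA : low n h \subset A by apply: contraT => /hmin; rewrite ltnn.
exists h => //; split=> // x.
suff main (i j : 'I_n) : x \in A -> (h <= i)%N -> (i < j)%N ->
    x 0 i != 0 -> x 0 j != 0 -> False.
  move=> i j xA hi hj xi xj; apply/val_inj; case: (ltngtP i j) => // ij.
    by case: (main i j).
  by case: (main j i).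
move=> xA hi ij xi xj; case/negP: hA; apply/subsetP => u uh.
pose g := Ordinal hn.
have hj : (h < j)%N by apply: leq_ltn_trans ij.
have ijA : unitv i + unitv j \in A.
  apply: (shifted_down shA A0 xA) => k; rewrite mxE F2_add_neq0 !unitvE.
  by do 2![case: eqP => [->|_] //=].
have gjA : unitv g + unitv j \in A.
  case: (eqVneq g i) => [-> //|gi].
  rewrite (_ : _ + _ = unitv i + unitv j + unitv i + unitv g).
    apply: shA => //; first by rewrite mxE F2_add_neq0 !unitvE eqxx -val_eqE ltn_eqF.
      exact: frame_unitv.
    by apply: low_unitv; rewrite ltn_neqAle hi andbT; move: gi; rewrite -val_eqE.
  by rewrite [_ + unitv i]addrAC F2_addrr add0r addrC.
have uhj u' : u' \in low n h -> u' \in low n j.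
  by move/lowP => u0; apply/lowP => k jk; apply: u0; rewrite ltnW // (leq_trans hj).
case: (boolP (u 0 g == 0)) => [ug|ug].
  apply: (subsetP lowA); apply/lowP => k; rewrite leq_eqVlt.
  case/orP=> [/eqP hk|]; last exact: (lowP uh).
  by move/eqP: ug => <-; congr (u 0 _); apply/val_inj.
have u'h : u + unitv g \in low n h.
  apply/lowP => k; rewrite leq_eqVlt => /orP[/eqP hk|hk].
    have -> : k = g by apply/val_inj.
    by apply/eqP; rewrite -[_ == 0]negbK mxE F2_add_neq0 ug unitvE eqxx.
  rewrite mxE (lowP uh) // add0r; apply/eqP.
  by rewrite -[_ == 0]negbK unitvE -val_eqE gtn_eqF.
rewrite (_ : u = unitv g + unitv j + unitv j + (u + unitv g)).
  apply: shA => //; last exact: uhj.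
    by rewrite mxE F2_add_neq0 !unitvE eqxx addbT -val_eqE gtn_eqF.
  exact: (subsetP lowA).
by rewrite F2_addrK addrC F2_addrK.
Qed.

(** Here a counts the elements with the top bit and a0 the others.  If
    a * 2^(m+2) <= 2^n, dropping them costs at most one of the m + 3 units 2^n.
    Otherwise, with s = n - h - 1 and s + u = m, the lower bound on a0 gives
    a0 * 2^(m+2) >= 2^n * (2^(u+1) + s), and 2^(u+1) >= u + 2.  The first of these
    is strict if s > 0, the second if s = 0, since then u = m > 0. *)
Lemma rare_top_bit n h a a0 m : (h < n)%N -> (0 < m)%N -> (a <= 2 ^ h)%N ->
  (2 ^ h + (n - h.+1) * a <= a0)%N ->
  ((m + 3) * 2 ^ n < (a0 + a) * 2 ^ (m + 2))%N ->
  ((m + 2) * 2 ^ n < a0 * 2 ^ (m + 2))%N.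
Proof.
move=> hn m0 ah a0P big.
case: (leqP (a * 2 ^ (m + 2)) (2 ^ n)) => [small|large]; first by lia.
have : (2 ^ n < 2 ^ (h + (m + 2)))%N.
  by apply: leq_trans large _; rewrite (expnD 2 h) leq_mul2r ah orbT.
rewrite ltn_exp2l // => nh.
have [u hu] : exists u, (h + (m + 2) = n + u.+1)%N by exists (h + (m + 2) - n.+1)%N; lia.
have pu : (u.+2 <= 2 ^ u.+1)%N by apply: ltn_expl.
have [s hs] : exists s, (n = h + s.+1)%N by exists (n - h.+1)%N; lia.
have sE : (n - h.+1 = s)%N by lia.
have muE : (m + 2 = s + u + 2)%N by lia.
have hE : (2 ^ h * 2 ^ (m + 2) = 2 ^ n * 2 ^ u.+1)%N by rewrite -!expnD hu.
rewrite sE in a0P.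
have n0 : (0 < 2 ^ n)%N by rewrite expn_gt0.
have step1 : (2 ^ n * 2 ^ u.+1 + s * (a * 2 ^ (m + 2)) <= a0 * 2 ^ (m + 2))%N.
  by rewrite -hE mulnA -mulnDl leq_mul2r a0P orbT.
apply: leq_trans step1; move: large n0 pu; rewrite muE.
set N := (2 ^ n)%N; set P := (2 ^ u.+1)%N; set L := (a * _)%N => large n0 pu.
case: s hs sE muE {a0P} @L large => [|s] hs sE muE L large.
  have u1 : (1 <= u)%N by lia.
  have : (u.+2 < P)%N.
    case: u u1 @P pu {hu muE hE L large} => // u _ P _.
    rewrite /P expnS mul2n -addnn.
    by have := ltn_expl u.+1 (isT : (1 < 2)%N); lia.
  nia.
nia.
Qed.

(** Trading the top bit p for a bit i with h <= i < p embeds the elements having bit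
    p into those having bit i, so the top bit is the rarest one and cutting it off
    concentrates A. *)
Lemma shifted_section n (p : 'I_n) (A : {set 'rV['F_2]_n}) m : p.+1 = n ->
  shifted A -> frame n \subset A -> A != setT -> (0 < m)%N ->
  ((m + 3) * 2 ^ n < #|A| * 2 ^ (m + 2))%N ->
  ((m + 2) * 2 ^ n < #|[set x in A | x 0%R p == 0%R]| * 2 ^ (m + 2))%N.
Proof.
move=> pn shA fA AT m0; have A0 := frame0 fA.
have [h hn [lowA one]] := shifted_low shA fA AT.
have hp : (h <= p)%N by rewrite -ltnS pn.
pose A1 := [set x in A | x 0 p != 0].
have A1P x : x \in A1 -> x \in A /\ x 0 p != 0 by rewrite inE => /andP.
have -> : #|A| = (#|[set x in A | x 0%R p == 0%R]| + #|A1|)%N.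
  rewrite -(cardsID [set x : 'rV['F_2]_n | x 0 p == 0] A); congr addn; apply: eq_card => x.
    by rewrite !inE.
  by rewrite !inE andbC.
pose C : {set 'rV['F_2]_n} := [set x + unitv p | x in A1].
have CA1 : #|C| = #|A1| by apply: card_imset (can_inj (F2_addrK _)).
have Clow : C \subset low n h.
  apply/subsetP => _ /imsetP[x /A1P[xA xp] ->]; apply/lowP => i hi.
  apply/eqP; rewrite -[_ == 0]negbK mxE F2_add_neq0 unitvE.
  case: (eqVneq i p) => [->|ip]; first by rewrite xp.
  by rewrite addbF; apply: contraNN ip => xi; rewrite (one x i p).
apply: (rare_top_bit hn) => //.
  by rewrite -CA1 -(card_low (ltnW hn)) subset_leq_card.
rewrite -CA1 -(card_low (ltnW hn)).
pose I := [set i : 'I_n | (h <= i)%N && (i < p)%N].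
have IP i : i \in I -> (h <= i)%N /\ (i < p)%N by rewrite inE => /andP.
have cI : #|I| = (n - h.+1)%N.
  transitivity (\sum_(h <= i < p) 1)%N; last by rewrite sum_nat_const_nat muln1 -{2}pn.
  rewrite (big_nat_widen _ _ n) ?(ltnW (ltn_ord p)) // big_geq_mkord /= -sum1_card.
  by apply: eq_bigl => i; rewrite inE andbC.
pose f (ic : 'I_n * 'rV['F_2]_n) := unitv ic.1 + ic.2.
have fN i c (j : 'I_n) : c \in low n h -> (h <= j)%N -> (f (i, c) 0 j != 0) = (j == i).
  by move=> /lowP ch hj; rewrite mxE F2_add_neq0 unitvE ch // addbF.
have inj_f : {in setX I C &, injective f}.
  move=> [i c] [j d] /setXP[/= /IP[hi _] /(subsetP Clow) cC].
  move=> /setXP[/= /IP[hj _] /(subsetP Clow) dC] fE.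
  have ij : i = j by apply/eqP; rewrite -(fN j d) // -fE fN.
  by move: fE; rewrite /f ij /= => /addrI ->.
rewrite -cI -cardsX -(card_in_imset inj_f) -cardsUI.
rewrite [X in (_ + #|pred_of_set X|)%N](_ : _ = set0) ?cards0 ?addn0; last first.
  apply/eqP; rewrite -subset0; apply/subsetP => x; rewrite inE => /andP[/lowP x0].
  case/imsetP => -[i c] /setXP[/= /IP[hi _] /(subsetP Clow) cC] xE.
  by move: (fN i c i cC hi); rewrite -xE x0 // !eqxx.
apply: subset_leq_card; apply/subsetP => x /setUP[xl|].
  by rewrite inE (subsetP lowA) //= (lowP xl).
case/imsetP => -[i c] /setXP[/= /IP[hi ip] cC] ->.
rewrite inE -[_ == 0]negbK fN ?(subsetP Clow) // -val_eqE gtn_eqF // andbT /f /=.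
case/imsetP: cC => y /A1P[yA yp] ->.
rewrite addrC; apply: shA => //; first exact: frame_unitv.
exact: low_unitv.
Qed.

(** * The extremal profile *)

(** The size of the ball of radius k - 1 of Z_2^m plus the fraction s of the sphere
    of radius k. *)
Definition profile (R : realType) (m k : nat) (s : R) : R :=
  \sum_(i < k) 'C(m, i)%:R + s * 'C(m, k)%:R.

(** Equal to C(m, j + 1) / C(m, j) for j <= m. *)
Definition slope (R : realType) (m j : nat) : R := (m - j)%:R / j.+1%:R.

(** The line through the points ([profile m j s], [profile m j.+1 s]), for
    s in [0, 1] and j <= m; the graph of the extremal function is made of these segments. *)
Definition line (R : realType) (m j : nat) (x : R) : R :=
  profile m j.+1 0 + slope R m j * (x - profile m j 0).

Lemma profile_succ (R : realType) m k : profile m k 1 = profile m k.+1 0 :> R.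
Proof. by rewrite /profile big_ord_recr /= mul1r mul0r addr0. Qed.

Lemma profileS (R : realType) m k : profile m k.+1 0 = profile m k 0 + 'C(m, k)%:R :> R.
Proof. by rewrite -profile_succ /profile; ring. Qed.

(** A coordinate hyperplane cuts a ball of radius k of Z_2^(m+1) into balls of radii
    k and k - 1 of Z_2^m. *)
Lemma profile_pascal (R : realType) m k (s : R) :
  profile m.+1 k.+1 s = profile m k.+1 s + profile m k s.
Proof.
have pascal j : \sum_(i < j.+1) 'C(m.+1, i)%:R =
    \sum_(i < j.+1) 'C(m, i)%:R + \sum_(i < j) 'C(m, i)%:R :> R.
  elim: j => [|j IH]; first by rewrite !big_ord_recr !big_ord0 /= !bin0; ring.
  rewrite big_ord_recr /= IH binS natrD [in RHS]big_ord_recr /=.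
  by rewrite [X in _ = _ + X]big_ord_recr /=; ring.
by rewrite /profile pascal binS natrD; ring.
Qed.

Lemma profile_full (R : realType) m k : (m < k)%N -> profile m k 0 = 2 ^+ m :> R.
Proof.
rewrite /profile mul0r addr0; elim: m k => [|m IH] [//|k] mk.
  by rewrite big_ord_recl /= bin0 big1 ?addr0.
have := profile_pascal m k (0 : R); rewrite /profile !mul0r !addr0 => ->.
by rewrite !IH // ?(ltnW mk) // exprS; ring.
Qed.

Lemma slope_ge0 (R : realType) m j : 0 <= slope R m j.
Proof. by rewrite divr_ge0 ?ler0n. Qed.

(** The extremal function lies below each of its supporting lines.  The difference
    D between the profile at k + 1 and the slope times the profile at k has
    increments of the sign of j - k, because C(m, k + 1) / C(m, k) decreases with k;
    hence D is largest at j. *)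
Lemma profile_le_line (R : realType) m j k (s : R) : (j <= m)%N -> 0 <= s <= 1 ->
  profile m k.+1 s <= line m j (profile m k s).
Proof.
move=> jm s01.
pose d i : R := 'C(m, i.+1)%:R - slope R m j * 'C(m, i)%:R.
pose D i : R := profile m i.+1 0 - slope R m j * profile m i 0.
have DS i : D i.+1 = D i + d i.
  by rewrite /D /d !profileS; ring.
have dE i : (i <= m)%N ->
    d i * (j.+1%:R * i.+1%:R) = 'C(m, i)%:R * m.+1%:R * (j%:R - i%:R).
  move=> im; have j0 : j.+1%:R != 0 :> R by rewrite pnatr_eq0.
  have := mul_bin_left m i => /(congr1 (fun n => n%:R : R)); rewrite !natrM natrB // => bE.
  have -> : d i * (j.+1%:R * i.+1%:R) =
     i.+1%:R * 'C(m, i.+1)%:R * j.+1%:R - (m%:R - j%:R) * i.+1%:R * 'C(m, i)%:R.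
    by rewrite /d /slope natrB //; field; rewrite nat1r.
  by rewrite bE -!natr1; ring.
have pos i : 0 < j.+1%:R * i.+1%:R :> R by rewrite mulr_gt0 ?ltr0n.
have d_ge0 i : (i <= j)%N -> 0 <= d i.
  move=> ij; rewrite -(pmulr_lge0 _ (pos i)) dE ?(leq_trans ij) //.
  by rewrite mulr_ge0 ?mulr_ge0 ?ler0n // subr_ge0 ler_nat.
have d_le0 i : (j <= i)%N -> d i <= 0.
  move=> ji; case: (leqP i m) => [im|mi].
    rewrite -(pmulr_lle0 _ (pos i)) dE // mulr_ge0_le0 ?mulr_ge0 ?ler0n //.
    by rewrite subr_le0 ler_nat.
  by rewrite /d !bin_small ?mulr0 ?subr0 // (leq_trans mi).
have D_up i : D (j + i)%N <= D j.
  elim: i => [|i IH]; rewrite ?addn0 // addnS DS.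
  by have := d_le0 (j + i)%N (leq_addr _ _); lra.
have D_down i : (i <= j)%N -> D (j - i)%N <= D j.
  elim: i => [|i IH] ij; first by rewrite subn0.
  have := IH (ltnW ij); have -> : (j - i = (j - i.+1).+1)%N by lia.
  by rewrite DS; have := d_ge0 (j - i.+1)%N (leq_subr _ _); lra.
have D_max i : D i <= D j.
  case: (leqP i j) => ij; first by rewrite -(subKn ij) D_down // leq_subr.
  by rewrite -(subnKC (ltnW ij)) D_up.
have lineE : line m j (profile m k s) = D j + slope R m j * profile m k s.
  by rewrite /line /D; ring.
have : profile m k.+1 s - slope R m j * profile m k s = (1 - s) * D k + s * D k.+1.
  rewrite DS /D /d /profile; ring.
rewrite lineE; move: (D_max k) (D_max k.+1) s01 => Dk DSk /andP[s0 s1].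
have : (1 - s) * D k <= (1 - s) * D j by rewrite ler_wpM2l // subr_ge0.
have : s * D k.+1 <= s * D j by rewrite ler_wpM2l.
lra.
Qed.

Lemma profile_eq_line (R : realType) m k (s : R) : (k <= m)%N ->
  line m k (profile m k s) = profile m k.+1 s.
Proof.
move=> km; have k0 : k.+1%:R != 0 :> R by rewrite pnatr_eq0.
have := mul_bin_left m k => /(congr1 (fun n => n%:R : R)); rewrite !natrM => bE.
have slE : slope R m k * 'C(m, k)%:R = 'C(m, k.+1)%:R.
  by apply: (mulfI k0); rewrite bE /slope mulrA mulrCA mulfV // mulr1.
rewrite /line /profile !mul0r !addr0; rewrite -slE; ring.
Qed.

Lemma line_le (R : realType) m j (x y : R) : x <= y -> line m j x <= line m j y.
Proof. by move=> xy; rewrite lerD2l ler_wpM2l ?slope_ge0 // lerD2r. Qed.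

Lemma exists_profile (R : realType) m (b : R) : 0 <= b <= 2 ^+ m ->
  exists k s, [/\ (k <= m)%N, 0 <= s <= 1 & b = profile m k s].
Proof.
move=> /andP[b0]; rewrite -(@profile_full R m m.+1) //.
suff main n : (n <= m.+1)%N -> b <= profile m n 0 ->
    exists k s, [/\ (k <= m)%N, 0 <= s <= 1 & b = profile m k s] by exact: main.
elim: n => [|n IH] nm bn.
  exists 0%N, 0; split=> //; first by rewrite lexx ler01.
  by apply/eqP; rewrite eq_le bn /= /profile big_ord0 mul0r addr0.
case: (leP b (profile m n 0)) => [|nb]; first by apply: IH; rewrite ltnW.
have c0 : 0 < 'C(m, n)%:R :> R by rewrite ltr0n bin_gt0.
exists n, ((b - profile m n 0) / 'C(m, n)%:R); split=> //.
  rewrite divr_ge0 ?subr_ge0 ?(ltW nb) ?(ltW c0) //= ler_pdivrMr // mul1r.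
  by move: bn; rewrite -profile_succ /profile; lra.
by rewrite /profile divfK ?gt_eqF //; ring.
Qed.

(** Of the two ways of moving the abscissas b0, b1 out to x and y, the one that
    takes the flatter line to y does not increase the sum of the heights. *)
Lemma lines_concave (R : realType) m j0 j1 (x y b0 b1 X Y : R) :
  (j0 <= m)%N -> (j1 <= m)%N ->
  (forall j, (j <= m)%N -> X <= line m j x) ->
  (forall j, (j <= m)%N -> Y <= line m j y) ->
  x <= b0 -> x <= b1 -> b0 + b1 = x + y ->
  X + Y <= line m j0 b0 + line m j1 b1.
Proof.
move=> j0m j1m HX HY xb0 xb1 bE.
have shift j u v : line m j v = line m j u + slope R m j * (v - u) :> R.
  by rewrite /line; ring.
case: (leP (slope R m j0) (slope R m j1)) => sl.
  have : 0 <= (slope R m j1 - slope R m j0) * (b1 - x) by rewrite mulr_ge0 ?subr_ge0.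
  rewrite (shift j0 y) (shift j1 x); have -> : b0 - y = - (b1 - x) by lra.
  by move: (HX _ j1m) (HY _ j0m); lra.
have : 0 <= (slope R m j0 - slope R m j1) * (b0 - x) by rewrite mulr_ge0 ?subr_ge0 // ltW.
rewrite (shift j1 y) (shift j0 x); have -> : b1 - y = - (b0 - x) by lra.
by move: (HX _ j0m) (HY _ j1m); lra.
Qed.

(** The arithmetic of the induction step: b0 >= b1 are the sizes of the halves of B
    and S0, S1 those of the halves of A + B.  Let x and y be the profiles of m at
    k - 1 and k, so that x + y is the size of B.  If b0 >= y, the bounds by the line
    at b0 and by b0 itself suffice; otherwise x < b1 and b0 < y, and the two lines
    are compared by concavity with their values at x and y. *)
Lemma profile_sections (R : realType) m k (s b0 b1 S0 S1 : R) :
  0 <= s <= 1 -> 0 <= b1 <= b0 -> b0 + b1 = profile m.+1 k s ->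
  (exists2 j, (j <= m)%N & line m j b0 <= S0) -> b0 <= S1 ->
  (0 < b1 -> exists2 j, (j <= m)%N & line m j b1 <= S1) ->
  profile m.+1 k.+1 s <= S0 + S1.
Proof.
move=> s01 /andP[b1_ge0 b10] bE [j0 j0m S0P] S1b0 S1b1.
have [x xE [x0 Xx]] : exists2 x, profile m.+1 k s = x + profile m k s &
    0 <= x /\ forall j, (j <= m)%N -> profile m k s <= line m j x.
  (* For k = 0 the point x is 0, where every line is at height at least 1 >= s. *)
  case: k {bE} => [|k].
    exists 0; first by rewrite /profile !big_ord0 !bin0; ring.
    split=> // j jm; apply: (@le_trans _ _ (profile m 1 0)).
      by rewrite -profile_succ /profile !big_ord0 bin0 !mulr1 !add0r; case/andP: s01.
    have := @profile_le_line R m j 0 0 jm; rewrite {2}/profile big_ord0 mul0r addr0.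
    by apply; rewrite lexx ler01.
  exists (profile m k s); first by rewrite profile_pascal addrC.
  split; last by move=> j jm; apply: profile_le_line.
  by case/andP: s01 => ? _; rewrite addr_ge0 ?mulr_ge0 ?sumr_ge0 ?ler0n.
rewrite profile_pascal; set y := profile m k s in xE Xx *.
have Yy j : (j <= m)%N -> profile m k.+1 s <= line m j y.
  by move=> jm; apply: profile_le_line.
case: (leP y b0) => [yb0|b0y].
  apply: lerD; last exact: le_trans S1b0.
  by apply: le_trans S0P; apply: le_trans (line_le _ _ yb0); exact: Yy.
have [j1 j1m S1P] : exists2 j, (j <= m)%N & line m j b1 <= S1 by apply: S1b1; lra.
have sum_xy : b0 + b1 = x + y by rewrite bE xE.
rewrite addrC; apply: le_trans (lerD S0P S1P).
by apply: (lines_concave j0m j1m Xx Yy); lra.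
Qed.

(** * Sections by the last coordinate *)

Lemma card_F2_rV n : #|{: 'rV['F_2]_n}| = (2 ^ n)%N.
Proof. by rewrite card_mx card_Fp // mul1n. Qed.

Lemma sumset_setTl n (B : {set 'rV['F_2]_n}) : B != set0 -> sumset [set: 'rV['F_2]_n] B = setT.
Proof.
case/set0Pn => b bB; apply/setP => x; rewrite inE.
by apply/imset2P; exists (x + b) b; rewrite ?inE ?F2_addrK.
Qed.

Lemma card_sumset_ge n (A B : {set 'rV['F_2]_n}) : A != set0 -> (#|B| <= #|sumset A B|)%N.
Proof.
case/set0Pn => a aA; rewrite -(card_imset B (can_inj (F2_addrK a))).
by apply/subset_leq_card/subsetP => _ /imsetP[b bB ->]; rewrite addrC; apply: mem_sumset.
Qed.

Definition append n (y : 'rV['F_2]_n) (b : 'F_2) : 'rV['F_2]_(n + 1) :=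
  row_mx y (const_mx b).

Definition section n (b : 'F_2) (A : {set 'rV['F_2]_(n + 1)}) : {set 'rV['F_2]_n} :=
  [set y | append y b \in A].

Lemma append_top n (y : 'rV['F_2]_n) (b : 'F_2) : append y b 0 (rshift n 0) = b.
Proof. by rewrite row_mxEr mxE. Qed.

Lemma append_bits n (y : 'rV['F_2]_n) (b : 'F_2) i :
  append y b 0 i = if split i is inl k then y 0 k else b.
Proof.
rewrite -{1}(splitK i).
by case: (split i) => k /=; rewrite ?row_mxEl // row_mxEr mxE.
Qed.

Lemma append_add n (x y : 'rV['F_2]_n) b c : append x b + append y c = append (x + y) (b + c).
Proof. by apply/rowP => i; rewrite mxE !append_bits; case: (split i) => k //; rewrite mxE. Qed.

Lemma card_section n b (A : {set 'rV['F_2]_(n + 1)}) :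
  #|section b A| = #|[set x in A | x 0 (rshift n 0) == b]|.
Proof.
have inj : injective (fun y : 'rV['F_2]_n => append y b) by move=> y z /eq_row_mx[].
rewrite -(card_imset _ inj); apply: eq_card => x; rewrite inE.
apply/imsetP/andP => [[y yA ->]|[xA /eqP xb]].
  by rewrite append_top eqxx; move: yA; rewrite inE.
have xE : x = append (lsubmx x) b.
  rewrite -{1}[x]hsubmxK; congr row_mx; apply/matrixP => i j; rewrite !mxE.
  by rewrite !ord1 xb.
by exists (lsubmx x); rewrite // inE -xE.
Qed.

Lemma card_sections n b (A : {set 'rV['F_2]_(n + 1)}) :
  #|A| = (#|section b A| + #|section (b + 1)%R A|)%N.
Proof.
rewrite !card_section -(cardsID [set x : 'rV['F_2]_(n + 1) | x 0 (rshift n 0) == b] A).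
congr addn; apply: eq_card => x; rewrite !inE // andbC; congr andb.
move: (x 0 _) => c.
by case: b => [[|[|]]] // ?; case: c => [[|[|]]].
Qed.

Lemma sumset_section n b c (A B : {set 'rV['F_2]_(n + 1)}) :
  sumset (section b A) (section c B) \subset section (b + c) (sumset A B).
Proof.
apply/subsetP => _ /imset2P[x y /[!inE] xA yB ->].
by rewrite -append_add mem_sumset.
Qed.

Lemma frame_section0 n (A : {set 'rV['F_2]_(n + 1)}) :
  frame (n + 1) \subset A -> frame n \subset section 0 A.
Proof.
move=> fA; apply/subsetP => x /setU1P[->|/imsetP[i _ ->]]; rewrite inE.
  by rewrite /append row_mx0 frame0.
rewrite (_ : append _ _ = unitv (lshift 1 i)) ?frame_unitv //.
apply/F2_rowP => j; rewrite unitvE append_bits -{2}(splitK j); case: (split j) => k /=.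
  by rewrite unitvE eq_lshift.
by rewrite eq_rlshift.
Qed.

Lemma frame_section1 n (A : {set 'rV['F_2]_(n + 1)}) :
  frame (n + 1) \subset A -> section 1 A != set0.
Proof.
move=> fA; apply/set0Pn; exists 0; rewrite inE.
rewrite (_ : append _ _ = unitv (rshift n 0)) ?frame_unitv //.
apply/F2_rowP => j; rewrite unitvE append_bits -{2}(splitK j); case: (split j) => k /=.
  by rewrite mxE eqxx eq_lrshift.
by rewrite eq_rshift ord1.
Qed.

(** * The lower bound for sets containing the unit vectors *)

Lemma card_sides n (p : 'I_n) b (X Y Z : {set 'rV['F_2]_n}) :
  (forall x, x \in X -> (x \in Z) && ((x 0 p != 0) == b)) ->
  (forall x, x \in Y -> (x \in Z) && ((x 0 p != 0) != b)) ->
  (#|X| + #|Y| <= #|Z|)%N.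
Proof.
move=> XZ YZ; rewrite -cardsUI [X in (_ + #|pred_of_set X|)%N](_ : _ = set0) ?cards0 ?addn0.
  by apply/subset_leq_card/subsetP => x /setUP[/XZ|/YZ]/andP[].
apply/eqP; rewrite -subset0; apply/subsetP => x /setIP[/XZ/andP[_ xb] /YZ/andP[_]].
by rewrite xb.
Qed.

(** With no set to keep, compression puts the whole hyperplane of top bit 0 into A,
    and A also has a point a with top bit 1.  Either B meets both sides of the
    hyperplane and A + B is everything, or A + B contains a translate of the
    hyperplane on one side and a + B on the other. *)
Lemma large_sumset n (A B : {set 'rV['F_2]_n}) : B != set0 -> (2 ^ n < 2 * #|A|)%N ->
  (2 ^ n <= #|sumset A B|)%N \/ (2 ^ n + 2 * #|B| <= 2 * #|sumset A B|)%N.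
Proof.
move=> B0 bigA.
have [AT|AT] := eqVneq A setT.
  by left; rewrite AT sumset_setTl // cardsT card_F2_rV.
case: n => [|n] in A B B0 bigA AT *.
  have : (#|A| < #|[set: 'rV['F_2]_0]|)%N by rewrite proper_card // properT.
  by move: bigA; rewrite cardsT card_F2_rV expn0; lia.
have [A' [B' [cA cB le_sum _ stab]]] := exists_stable B (sub0set A).
suff: (2 ^ n.+1 <= #|sumset A' B'|)%N \/ (2 ^ n.+1 + 2 * #|B'| <= 2 * #|sumset A' B'|)%N.
  by rewrite -cB; case; [left|right]; lia.
rewrite -cA in bigA; have {B0} /set0Pn[b bB] : B' != set0 by rewrite -card_gt0 cB card_gt0.
have lowE x : (x \in low n.+1 n) = (x 0 ord_max == 0).
  apply/lowP/eqP => [|x0 i hi]; first exact.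
  by rewrite -x0; congr (x 0 _); apply/val_inj/eqP; rewrite eqn_leq hi -ltnS ltn_ord.
have cL : #|low n.+1 n| = (2 ^ n)%N by rewrite card_low.
have LA : low n.+1 n \subset A'.
  apply/subsetP => x xL; apply: contraT => xA.
  suff : A' \proper low n.+1 n by move/proper_card; move: bigA; rewrite cL expnS; lia.
  apply/properP; split; last by exists x.
  apply/subsetP => z zA; rewrite lowE; apply: contraNT xA => zp.
  have xzp : (x + z) 0 ord_max != 0 by move: xL; rewrite lowE mxE F2_add_neq0 zp => ->.
  rewrite -(stab ord_max (x + z)) ?sub0set //.
    have zE : x + (x + z) = z by rewrite addrA F2_addrr add0r.
    by rewrite inE; move: xL; rewrite lowE => ->; rewrite zE zA orbT.
  rewrite /pivot xzp; apply/forallP => i; apply/implyP => /leq_ltn_trans/(_ (ltn_ord i)).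
  by rewrite ltnn.
have [a aA ap] : exists2 a, a \in A' & a 0 ord_max != 0.
  suff /subsetPn[a aA] : ~~ (A' \subset low n.+1 n) by rewrite lowE => ap; exists a.
  by apply/negP => /subset_leq_card; move: bigA; rewrite cL expnS; lia.
have Lside c x : c \in B' -> x \in [set y + c | y in low n.+1 n] ->
    (x \in sumset A' B') && ((x 0 ord_max != 0) == (c 0 ord_max != 0)).
  move=> cB' /imsetP[y yL ->]; rewrite mem_sumset ?(subsetP LA) //=.
  by move: yL; rewrite lowE mxE F2_add_neq0 => ->.
have cLc c : #|[set y + c | y in low n.+1 n]| = (2 ^ n)%N.
  by rewrite card_imset //; apply: can_inj (F2_addrK c).
case: (boolP [exists c : 'rV['F_2]_n.+1,
    (c \in B') && ((c 0 ord_max != 0) != (b 0 ord_max != 0))]).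
  case/existsP => c /andP[cB' cb]; left.
  have := card_sides (Lside b^~ bB) (Y := [set y + c | y in low n.+1 n]).
  rewrite !cLc addnn -mul2n -expnS; apply => x /(Lside _ _ cB') /andP[-> /eqP->].
  by rewrite cb.
rewrite negb_exists => /forallP sameB; right.
rewrite expnS -mulnDr leq_mul2l /= -{1}(cLc b) -(card_imset B' (can_inj (F2_addrK a))).
apply: (card_sides (Lside b^~ bB)) => x /imsetP[c cB' ->].
rewrite addrC mem_sumset //= mxE F2_add_neq0 ap.
by move: (sameB c); rewrite cB' /= negbK => /eqP->; case: (b 0 ord_max != 0).
Qed.

(** The number of points of Z_2^n above each point of a quotient Z_2^m; dividing by
    it measures subsets of Z_2^n in Z_2^m. *)
Definition fiber_size (R : realType) (m n : nat) : R := 2 ^+ n / 2 ^+ m.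

(** The existence of j says that the size of A + B is at least the minimum of the
    lines, which is the extremal function.  Leaving j free, rather than choosing the
    segment above the size of B, is what [lines_concave] needs for both halves. *)
Lemma frame_sumset (R : realType) m n (A B : {set 'rV['F_2]_n}) :
  frame n \subset A -> B != set0 ->
  ((m.+1 + 3) * 2 ^ n < #|A| * 2 ^ (m.+1 + 2))%N ->
  exists2 j, (j <= m.+1)%N &
    line m.+1 j (#|B|%:R / fiber_size R m.+1 n) <= #|sumset A B|%:R / fiber_size R m.+1 n.
Proof.
have size_gt0 k l : 0 < fiber_size R k l by rewrite divr_gt0 ?exprn_gt0.
have sizeE k l : 2 ^+ l / fiber_size R k l = 2 ^+ k.
  by rewrite /fiber_size invf_div mulrCA mulfV ?mulr1 // expf_neq0 ?pnatr_eq0.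
(* The line of index k is horizontal, at the height 2^k of the whole space. *)
have full k l X : (2 ^ l <= X)%N ->
    exists2 j, (j <= k)%N & forall x, line k j x <= X%:R / fiber_size R k l.
  move=> lX; exists k => // x; rewrite /line /slope subnn !mul0r addr0 profile_full //.
  by rewrite -(sizeE k l) ler_pM2r ?invr_gt0 // -natrX ler_nat.
elim: m n A B => [|m IH] n A B fA B0 bigA.
  have : (2 ^ n < 2 * #|A|)%N by move: bigA; rewrite (_ : 2 ^ (1 + 2) = 8)%N //; lia.
  case/(large_sumset B0) => [/(full 1%N)[j jm jP]|half]; first by exists j.
  exists 0%N => //.
  rewrite /line /slope /profile big_ord0 big_ord_recl big_ord0 bin0.
  rewrite !mul0r !addr0 subr0 divr1 mul1r.
  rewrite -(ler_pM2r (size_gt0 1%N n)) mulrDl !divfK ?gt_eqF ?size_gt0 // mul1r.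
  rewrite /fiber_size expr1; move: half; rewrite -(ler_nat R) natrD !natrM natrX; lra.
have [A' [B' [cA cB le_sum fA' stab]]] := exists_stable B fA.
have {}B0 : B' != set0 by rewrite -card_gt0 cB card_gt0.
suff [j jm jP] : exists2 j, (j <= m.+2)%N &
    line m.+2 j (#|B'|%:R / fiber_size R m.+2 n) <= #|sumset A' B'|%:R / fiber_size R m.+2 n.
  exists j => //; rewrite -cB; apply: le_trans jP _.
  by rewrite ler_pM2r ?invr_gt0 // ler_nat.
rewrite -cA in bigA; have shA := stable_shifted fA' stab.
clear cA cB le_sum stab fA A B; rename A' into A, B' into B, fA' into fA.
have [AT|AT] := eqVneq A setT.
  have /(full m.+2)[j jm jP] : (2 ^ n <= #|sumset A B|)%N.
    by rewrite AT sumset_setTl // cardsT card_F2_rV.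
  by exists j.
have [n' nE] : exists n', n = (n' + 1)%N.
  case: n => [|n] in A AT fA {B B0 bigA shA} *; last by exists n; rewrite addn1.
  case/eqP: AT; apply/setP => x; rewrite inE (_ : x = 0) ?frame0 //.
  by apply/rowP => -[].
subst n; rename n' into n.
set U := fiber_size R m.+2 (n + 1); have U0 : 0 < U by apply: size_gt0.
have UE : U = fiber_size R m.+1 n.
  rewrite /U /fiber_size addn1 !exprS invfM mulrACA mulfV ?mul1r ?pnatr_eq0 //.
(* The section has the size required for m one smaller, in the same unit U. *)
have bigA0 : ((m.+1 + 3) * 2 ^ n < #|section 0%R A| * 2 ^ (m.+1 + 2))%N.
  have := @shifted_section _ (rshift n 0) A m.+2 _ shA fA AT isT bigA.
  rewrite -card_section /= addn0 addn1 => /(_ erefl).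
  rewrite (_ : m.+2 + 2 = (m.+1 + 2).+1)%N // !(expnS 2); lia.
have IH0 (C : {set 'rV['F_2]_n}) : C != set0 -> exists2 j, (j <= m.+1)%N &
    line m.+1 j (#|C|%:R / U) <= #|sumset (section 0 A) C|%:R / U.
  by move=> C0; rewrite UE; apply: IH => //; apply: frame_section0.
(* The side b holds the larger half of B. *)
have [b leb] : exists b, (#|section (b + 1)%R B| <= #|section b B|)%N.
  case: (leqP #|section (0 + 1)%R B| #|section 0%R B|)%N => [|/ltnW]; first by exists 0.
  move=> le01; exists 1; move: le01.
  by rewrite add0r (_ : 1 + 1 = 0 :> 'F_2) //; apply/val_inj.
have b0N : section b B != set0.
  rewrite -card_gt0; move: B0; rewrite -card_gt0 (card_sections b B) !lt0n.
  by apply: contra => /eqP sb; move: leb; rewrite sb leqn0 => /eqP->.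
have [k [s [km s01 bE]]] : exists k s,
    [/\ (k <= m.+2)%N, 0 <= s <= 1 & #|B|%:R / U = profile m.+2 k s].
  apply: exists_profile; rewrite divr_ge0 ?(ltW U0) //= -(sizeE m.+2 (n + 1)%N).
  by rewrite ler_pM2r ?invr_gt0 // -natrX ler_nat -card_F2_rV max_card.
exists k => //; rewrite bE profile_eq_line // (card_sections b) natrD mulrDl.
have leU (x y : nat) : (x <= y)%N -> x%:R / U <= y%:R / U.
  by move=> xy; rewrite ler_pM2r ?invr_gt0 // ler_nat.
apply: (@profile_sections R m.+1 k s
  (#|section b B|%:R / U) (#|section (b + 1) B|%:R / U)) => //.
- by rewrite divr_ge0 ?(ltW U0) //= leU.
- by rewrite -mulrDl -natrD -card_sections.
- have [j jm jP] := IH0 _ b0N; exists j => //; apply: le_trans jP (leU _ _ _).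
  by apply: subset_leq_card; have := sumset_section 0 b A B; rewrite add0r.
- apply: leU; apply: leq_trans (card_sumset_ge _ (frame_section1 fA)) _.
  by apply: subset_leq_card; have := sumset_section 1 b A B; rewrite addrC.
rewrite pmulr_lgt0 ?invr_gt0 // ltr0n card_gt0 => /IH0[j jm jP]; exists j => //.
apply: le_trans jP (leU _ _ _).
by apply: subset_leq_card; have := sumset_section 0 (b + 1) A B; rewrite add0r.
Qed.

(** * Reduction to sets containing the unit vectors *)

(** Translate A by one of its points a0.  The row space of the translated points is
    a subgroup whose coset at a0 contains A, so it is everything; some n of the
    points form an invertible matrix P, and multiplication by the inverse of P
    takes them to the unit vectors. *)
Lemma exists_frame n (A B : {set 'rV['F_2]_n}) : is_affine_span A setT -> A != set0 ->
  exists A' B' : {set 'rV['F_2]_n},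
  [/\ frame n \subset A', #|A'| = #|A|, #|B'| = #|B| & #|sumset A' B'| = #|sumset A B|].
Proof.
move=> [_ _ spanA] /set0Pn[a0 a0A].
pose M : 'M['F_2]_(#|A|, n) := \matrix_(i < #|A|) (enum_val i + a0).
have rowM i : row i M = enum_val i + a0 by rewrite rowK.
have MA a : a \in A -> ((a + a0)%R <= M)%MS.
  move=> aA; have := row_sub (enum_rank_in aA a) M.
  by rewrite rowM (enum_rankK_in aA aA).
pose H := [set x : 'rV['F_2]_n | (x <= M)%MS].
have gH : group_set H.
  apply/group_setP; split=> [|x y]; first by rewrite inE sub0mx.
  by rewrite !inE; apply: addmx_sub.
have fullM : row_full M.
  have HT : [set: 'rV['F_2]_n] \subset (Group gH :* a0)%g.
    apply: spanA; first by exists (Group gH), a0.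
    apply/subsetP => a aA; apply/rcosetP; exists (a + a0); first by rewrite inE MA.
    by rewrite -[(_ * _)%g]/(a + a0 + a0) F2_addrK.
  rewrite -sub1mx; apply/row_subP => i.
  have /rcosetP[x] := subsetP HT (row i 1%:M + a0) (in_setT _).
  by rewrite inE => xM /(@addIr _ a0) ->.
set P := rowsub (fullrankfun fullM) M.
have unitP : P \in unitmx by apply: fullrowsub_unit.
have rowPA i : exists2 a, a \in A & row i P = a + a0.
  by exists (enum_val (fullrankfun fullM i)); rewrite ?enum_valP // row_rowsub rowM.
have injP : injective (fun x : 'rV['F_2]_n => x *m invmx P).
  exact: can_inj (mulmxKV unitP).
have injA : injective (fun x : 'rV['F_2]_n => (x + a0) *m invmx P).
  by move=> x y /injP/addIr.
exists [set (x + a0) *m invmx P | x in A], [set x *m invmx P | x in B].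
split; rewrite ?card_imset //.
  apply/subsetP => x /setU1P[->|/imsetP[i _ ->]]; apply/imsetP.
    by exists a0; rewrite // F2_addrr mul0mx.
  have [a aA aE] := rowPA i; exists a => //.
  by rewrite -aE -row_mul mulmxV // rowE mulmx1.
rewrite -[RHS](card_imset _ injA); apply: eq_card => x; apply/imset2P/imsetP.
  case=> _ _ /imsetP[a aA ->] /imsetP[b bB ->] ->; exists (a + b); first exact: mem_sumset.
  by rewrite -mulmxDl addrAC.
case=> _ /imset2P[a b aA bB ->] ->.
exists ((a + a0) *m invmx P) (b *m invmx P).
- by apply/imsetP; exists a.
- by apply/imsetP; exists b.
by rewrite -mulmxDl addrAC.
Qed.

(** By Pascal's rule the graph of (density of B, bound) over w in [-1, 1] is the
    segment of index k for m = t - 1, with s = (1 + w) / 2. *)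
Lemma ball_density_profile (R : realType) m k (w : R) :
  ball_density m.+1 k w = profile m k ((1 + w) / 2) / 2 ^+ m.
Proof.
have pascal : profile m.+1 k.+1 0 = profile m k 0 + 'C(m, k)%:R + profile m k 0 :> R.
  by rewrite profile_pascal profileS.
rewrite /ball_density [m.+1.-1]/= (_ : \sum_(i < k.+1) _ = profile m.+1 k.+1 0); last first.
  by rewrite /profile mul0r addr0.
rewrite pascal /profile mul0r addr0 exprS; field.
by rewrite expf_neq0 ?pnatr_eq0.
Qed.

Lemma sumset_lower_bound (R : realType) n (A B : {set 'rV['F_2]_n}) t k (w : R) :
  is_affine_span A [set: 'rV['F_2]_n] -> B != set0 ->
  #|A|%:R <= 3%:R / 4%:R * #|{: 'rV['F_2]_n}|%:R :> R ->
  is_largest_index R A t -> -1 <= w <= 1 ->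
  #|B|%:R = ball_density t k w * #|{: 'rV['F_2]_n}|%:R ->
  ball_density t k.+1 w * #|{: 'rV['F_2]_n}|%:R <= #|sumset A B|%:R.
Proof.
move=> spanA B0; rewrite card_F2_rV natrX => A34 [_ maxt] /andP[w1 w2].
have t2 : (2 <= t)%N by apply: maxt; split=> //; rewrite card_F2_rV natrX expr2 -natrM.
case: t t2 => [|[|m]] // _ in maxt *.
(* Otherwise t + 1 would satisfy the inequality of which t is the largest solution. *)
have bigA : ((m.+1 + 3) * 2 ^ n < #|A| * 2 ^ (m.+1 + 2))%N.
  rewrite ltnNge; apply/negP => small; have := maxt m.+3; rewrite ltnn => H.
  suff : false by []; apply: H; split=> //; rewrite card_F2_rV natrX mulrAC.
  rewrite ler_pdivlMr ?exprn_gt0 // -!natrX -!natrM ler_nat.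
  by move: small; rewrite addn3 addn2.
rewrite !ball_density_profile => BE.
have s01 : 0 <= (1 + w) / 2 <= 1 by apply/andP; split; lra.
have A0 : A != set0 by rewrite -card_gt0; case: #|A| bigA => //; rewrite mul0n.
have [A' [B' [fA' cA cB cAB]]] := exists_frame B spanA A0.
have B'0 : B' != set0 by rewrite -card_gt0 cB card_gt0.
rewrite -cA in bigA; have [j jm] := frame_sumset R fA' B'0 bigA.
have U0 : 0 < fiber_size R m.+1 n by rewrite divr_gt0 ?exprn_gt0.
have sizeE (x : R) : x / 2 ^+ m.+1 * 2 ^+ n = x * fiber_size R m.+1 n.
  by rewrite mulrAC -mulrA.
rewrite cAB cB BE !sizeE mulfK ?gt_eqF // ler_pdivlMr // => jP.
by apply: le_trans jP; rewrite ler_pM2r // profile_le_line.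
Qed.

(** * Hamming balls and cylinders *)

Lemma card_hamming_ball t k : #|hamming_ball k t| = (\sum_(i < k.+1) 'C(t, i))%N.
Proof.
pose supp (x : 'rV['F_2]_t) := [set i | x 0 i == 1].
have supp_inj : injective supp.
  by move=> x y /setP xy; apply/F2_rowP => i; have := xy i; rewrite !inE !F2_neq0.
have -> : #|hamming_ball k t| = #|[set S : {set 'I_t} | (#|S| <= k)%N]|.
  rewrite -(card_imset _ supp_inj); apply: eq_card => S; rewrite inE.
  apply/imsetP/idP => [[x xk ->]|Sk]; first by rewrite inE in xk.
  have SE : S = supp (\row_i (i \in S)%:R).
    by apply/setP => i; rewrite inE mxE; case: (i \in S).
  by exists (\row_i (i \in S)%:R); rewrite // inE -/(supp _) -SE.
elim: k => [|k IH].
  rewrite big_ord_recl big_ord0 bin0 addn0.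
  transitivity #|[set (set0 : {set 'I_t})]|; last exact: cards1.
  by apply: eq_card => S; rewrite !inE leqn0 cards_eq0.
rewrite big_ord_recr /= -IH.
have <- : #|[set S : {set 'I_t} | #|S| == k.+1]| = 'C(t, k.+1) by rewrite card_draws card_ord.
rewrite -(cardsID [set S : {set 'I_t} | (#|S| <= k)%N]
  [set S : {set 'I_t} | (#|S| <= k.+1)%N]).
congr addn; apply: eq_card => S; rewrite !inE; lia.
Qed.

Lemma hamming_ball_unitv t (i : 'I_t) : unitv i \in hamming_ball 1 t.
Proof.
rewrite inE; apply/card_le1_eqP => j l; rewrite !inE -!F2_neq0 !unitvE.
by move=> /eqP-> /eqP->.
Qed.

Lemma hamming_ball0 t k : 0 \in hamming_ball k t.
Proof.
rewrite inE (_ : [set _ | _] = set0) ?cards0 //.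
by apply/setP => i; rewrite !inE mxE.
Qed.

Lemma sumset_hamming_ball t k :
  sumset (hamming_ball 1 t) (hamming_ball k t) = hamming_ball k.+1 t.
Proof.
apply/setP => x; apply/imset2P/idP => [[a b]|].
  rewrite !inE => a1 bk ->.
  apply: (@leq_trans #|[set i | a 0 i == 1] :|: [set i | b 0 i == 1]|).
    apply/subset_leq_card/subsetP => i; rewrite !inE -!F2_neq0 mxE F2_add_neq0.
    by case: (_ != _) => //= ->.
  by rewrite cardsU (leq_trans (leq_subr _ _)) // (leq_trans (leq_add a1 bk)).
have [x0|[i]] := set_0Vmem [set i | x 0 i == 1].
  exists 0 x; rewrite ?add0r ?hamming_ball0 // inE x0 cards0 //.
rewrite !inE => xi xk; exists (unitv i) (x + unitv i).
- exact: hamming_ball_unitv.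
- rewrite inE -ltnS; apply: leq_trans xk; apply: proper_card; apply/properP; split.
    apply/subsetP => j; rewrite !inE -!F2_neq0 mxE F2_add_neq0 unitvE.
    by case: (eqVneq j i) => [->|_]; rewrite ?F2_neq0 ?xi ?addbF.
  by exists i; rewrite !inE // -F2_neq0 mxE F2_add_neq0 unitvE eqxx F2_neq0 xi.
by rewrite addrC F2_addrK.
Qed.

Definition truncate n t (le_tn : (t <= n)%N) (z : 'rV['F_2]_n) :
    'rV['F_2]_t :=
  \row_i z 0 (widen_ord le_tn i).

Lemma truncate_add n t (le_tn : (t <= n)%N) y z :
  truncate le_tn (y + z) = truncate le_tn y + truncate le_tn z.
Proof. by apply/rowP => i; rewrite !mxE. Qed.

Lemma truncate_castmx n t (le_tn : (t <= n)%N) x y :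
  truncate le_tn (castmx (erefl 1%N, subnKC le_tn) (row_mx x y)) = x.
Proof.
apply/rowP => i; rewrite mxE castmxE -[RHS](row_mxEl x y); congr (row_mx _ _ _ _).
  exact: val_inj.
exact: val_inj.
Qed.

Lemma mem_cylinder n t (le_tn : (t <= n)%N) X z :
  (z \in cylinder le_tn X) = (truncate le_tn z \in X).
Proof.
apply/imset2P/idP => [[x y xX _ ->]|zX]; first by rewrite truncate_castmx.
pose z' := castmx (esym (erefl 1%N), esym (subnKC le_tn)) z.
have zE : z = castmx (erefl 1%N, subnKC le_tn) (row_mx (lsubmx z') (rsubmx z')).
  by rewrite hsubmxK castmxKV.
by exists (lsubmx z') (rsubmx z'); rewrite ?inE //; move: zX; rewrite {1}zE truncate_castmx.
Qed.

Lemma card_cylinder n t (le_tn : (t <= n)%N) (X : {set 'rV['F_2]_t}) :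
  #|cylinder le_tn X| = (#|X| * 2 ^ (n - t))%N.
Proof.
rewrite /cylinder curry_imset2X card_imset; last first.
  move=> [x y] [x' y'] /= xyE; have := xyE => /(can_inj (castmxK _ _))/eq_row_mx[-> ->] //.
by rewrite cardsX cardsT card_F2_rV.
Qed.

Lemma sumset_cylinder n t (le_tn : (t <= n)%N) X Y :
  sumset (cylinder le_tn X) (cylinder le_tn Y) = cylinder le_tn (sumset X Y).
Proof.
apply/setP => z; rewrite mem_cylinder; apply/imset2P/imset2P => [[a b]|[x y xX yY zE]].
  rewrite !mem_cylinder => aX bY ->; exists (truncate le_tn a) (truncate le_tn b) => //.
  exact: truncate_add.
pose a := castmx (erefl 1%N, subnKC le_tn) (row_mx x 0).
exists a (z + a); rewrite ?mem_cylinder ?truncate_castmx //.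
  by rewrite truncate_add zE truncate_castmx addrC addrA F2_addrr add0r.
by rewrite addrC F2_addrK.
Qed.

(** A coset containing 0 is a subgroup, and the unit vectors generate everything. *)
Lemma frame_span n (A : {set 'rV['F_2]_n}) : frame n \subset A ->
  is_affine_span A [set: 'rV['F_2]_n].
Proof.
move=> fA; split; first 1 last.
- exact: subsetT.
- move=> _ [H [x ->]] AH; have := subsetP AH _ (frame0 fA).
  rewrite mem_rcoset mul1g groupV => xH; rewrite rcoset_id // in AH *.
  apply/subsetP => z _; rewrite (row_sum_delta z).
  apply: (big_ind (fun y : 'rV['F_2]_n => y \in H)) => [||i _].
  + exact: group1.
  + exact: groupM.
  have uH : unitv i \in H by apply: (subsetP AH); apply: frame_unitv.
  case: (z 0 i) => [[|[|//]]] ?.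
    by rewrite (_ : Ordinal _ = 0) ?scale0r ?group1 //; apply/val_inj.
  by rewrite (_ : Ordinal _ = 1) ?scale1r //; apply/val_inj.
exists [group of [set: 'rV['F_2]_n]], 0; rewrite -[0]/(1%g) mulg1 //.
Qed.

Lemma frame_cylinder n t (le_tn : (t <= n)%N) :
  frame n \subset cylinder le_tn (hamming_ball 1 t).
Proof.
apply/subsetP => x; rewrite mem_cylinder => /setU1P[->|/imsetP[i _ ->]].
  by rewrite (_ : truncate le_tn 0 = 0) ?hamming_ball0 //; apply/rowP => i; rewrite !mxE.
rewrite inE; apply/card_le1_eqP => j l.
rewrite !inE -!F2_neq0 mxE !unitvE [truncate _ _ _ _]mxE unitvE.
move=> /eqP ji /eqP li; apply/val_inj.
exact: (congr1 val (etrans li (esym ji))).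
Qed.

Lemma three_quarters t : (2 <= t)%N -> (4 * t.+1 <= 3 * 2 ^ t)%N.
Proof.
elim: t => // -[//|[|t]] IH _ //; have := IH isT; rewrite (expnS 2 t.+2); lia.
Qed.

(** The sequence (s + 1) / 2^s is strictly decreasing from s = 1 on. *)
Lemma succ_div_pow2_antitone t s : (0 < t)%N -> (t.+1 * 2 ^ s <= s.+1 * 2 ^ t)%N -> (s <= t)%N.
Proof.
move=> t0; rewrite (leqNgt s); apply: contraL => ts; rewrite -ltnNge.
have [d ->] : exists d, s = (t + d.+1)%N.
  by exists (s - t.+1)%N; rewrite addnS -addSn subnKC.
have : (d.+1 < 2 ^ d.+1)%N by apply: ltn_expl.
rewrite expnD mulnCA mulnC ltn_pmul2l ?expn_gt0 //; nia.
Qed.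

Theorem theorem1 (R : realType) :
  (forall (n : nat) (A B : {set 'rV['F_2]_n}) (t k : nat) (w : R),
     is_affine_span A [set: 'rV['F_2]_n] ->
     B != set0 ->
     #|A|%:R <= 3%:R / 4%:R * #|{: 'rV['F_2]_n}|%:R :> R ->
     is_largest_index R A t ->
     (k < t)%N ->
     -1 <= w <= 1 ->
     #|B|%:R = ball_density t k w * #|{: 'rV['F_2]_n}|%:R ->
     #|sumset A B|%:R >= ball_density t k.+1 w * #|{: 'rV['F_2]_n}|%:R)
  /\
  (forall (n t k : nat) (le_tn : (t <= n)%N),
     (2 <= t)%N ->
     (k < t)%N ->
     let A := cylinder le_tn (hamming_ball 1 t) in
     let B := cylinder le_tn (hamming_ball k t) in
     [/\ is_affine_span A [set: 'rV['F_2]_n],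
         B != set0,
         #|A|%:R <= 3%:R / 4%:R * #|{: 'rV['F_2]_n}|%:R :> R &
         is_largest_index R A t] /\
     [/\ #|B|%:R = ball_density t k (0 : R) * #|{: 'rV['F_2]_n}|%:R,
         sumset A B = cylinder le_tn (hamming_ball k.+1 t) &
         #|sumset A B|%:R
           = ball_density t k.+1 (0 : R) * #|{: 'rV['F_2]_n}|%:R]).
Proof.
split=> [n A B t k w spanA B0 A34 maxt _|n t k le_tn t2 _ A B].
  exact: sumset_lower_bound.
have nE : (2 ^ n = 2 ^ t * 2 ^ (n - t))%N by rewrite -expnD subnKC.
have ballE j : #|cylinder le_tn (hamming_ball j t)|%:R =
    ball_density t j (0 : R) * #|{: 'rV['F_2]_n}|%:R.
  rewrite card_cylinder card_hamming_ball card_F2_rV nE !natrM natr_sum !natrX.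
  by rewrite /ball_density mul0r addr0 [in RHS]mulrA divfK // expf_neq0 ?pnatr_eq0.
have ABE : sumset A B = cylinder le_tn (hamming_ball k.+1 t).
  by rewrite sumset_cylinder sumset_hamming_ball.
have cA : #|A| = (t.+1 * 2 ^ (n - t))%N.
  by rewrite card_cylinder card_hamming_ball !big_ord_recl big_ord0 bin0 bin1 addn0.
have sizeP s : (#|A|%:R <= s.+1%:R / 2 ^+ s * #|{: 'rV['F_2]_n}|%:R :> R) =
    (t.+1 * 2 ^ s <= s.+1 * 2 ^ t)%N.
  rewrite cA card_F2_rV nE mulrAC ler_pdivlMr ?exprn_gt0 // -natrX -!natrM ler_nat.
  by rewrite mulnAC mulnA leq_pmul2r ?expn_gt0.
split; last by split; rewrite ?ABE; by [|apply: ballE].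
split.
- exact: frame_span (frame_cylinder le_tn).
- apply/set0Pn; exists 0; rewrite mem_cylinder (_ : truncate _ 0 = 0) ?hamming_ball0 //.
  by apply/rowP => i; rewrite !mxE.
- rewrite cA card_F2_rV nE mulrAC ler_pdivlMr ?ltr0n // -!natrM ler_nat.
  by rewrite mulnAC mulnA leq_pmul2r ?expn_gt0 // mulnC three_quarters.
split=> [|s [s0]]; first by rewrite sizeP (ltnW t2) leqnn.
by rewrite sizeP; apply: succ_div_pow2_antitone; rewrite ltnW.
Qed.
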